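(* Let $\mathcal C$ be a strict braided monoidal category with equalizers and coequalizers. Let $H$ be an object of $\mathcal C$ equipped with a monoid structure $(H,\eta_H,\mu_H)$ and a comonoid structure $(H,\varepsilon_H,\delta_H)$ satisfying conditions (a1), (a2) and (a3) of the context. Then the following assertions are equivalent: (i) $H$ is a weak Hopf algebra. (ii) The morphism $f=q_{R}^{1}\circ \beta\circ j_{L}^{1}:H\times_{L}^{1} H\rightarrow H\times_{R}^{1} H$ is an isomorphism. (iii) The morphism $g=q_{L}^{2}\circ \gamma\circ j_{R}^{2}:H\times_{R}^{2} H\rightarrow H\times_{L}^{2} H$ is an isomorphism.
   Context: $\mathcal C$ has tensor product $\otimes$, unit object $K$ and braiding $c_{M,N}:M\otimes N\to N\otimes M$. An object $M$ also denotes its identity morphism in tensor products, e.g. $M\otimes f=id_M\otimes f$. Since $\mathcal C$ has equalizers (and coequalizers), all idempotents split. A monoid is unital and associative; a comonoid is counital and coassociative. $\delta_{H\otimes H}=(H\otimes c_{H,H}\otimes H)\circ(\delta_H\otimes\delta_H)$. For $u,v:H\to H$ the convolution is $u\ast v=\mu_H\circ(u\otimes v)\circ\delta_H$. Conditions: (a1) $\delta_{H}\circ \mu_{H}=(\mu_{H}\otimes \mu_{H})\circ \delta_{H\otimes H}$. (a2) $\varepsilon_{H}\circ \mu_{H}\circ (\mu_{H}\otimes H)=\varepsilon_{H}\circ \mu_{H}\circ (H\otimes \mu_{H})= ((\varepsilon_{H}\circ \mu_{H})\otimes (\varepsilon_{H}\circ\mu_{H}))\circ (H\otimes \delta_{H}\otimes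 H)=((\varepsilon_{H}\circ \mu_{H})\otimes (\varepsilon_{H}\circ\mu_{H}))\circ (H\otimes (c_{H,H}^{-1}\circ\delta_{H})\otimes H)$. (a3) $(\delta_{H}\otimes H)\circ \delta_{H}\circ \eta_{H}=(H\otimes\mu_{H}\otimes H)\circ ((\delta_{H}\circ \eta_{H}) \otimes (\delta_{H}\circ\eta_{H}))=(H\otimes (\mu_{H}\circ c_{H,H}^{-1})\otimes H)\circ ((\delta_{H}\circ \eta_{H}) \otimes (\delta_{H}\circ \eta_{H}))$. Define $\Pi_{H}^{L}=((\varepsilon_{H}\circ\mu_{H})\otimes H)\circ (H\otimes c_{H,H})\circ ((\delta_{H}\circ \eta_{H})\otimes H)$ and $\Pi_{H}^{R}=(H\otimes(\varepsilon_{H}\circ \mu_{H}))\circ (c_{H,H}\otimes H)\circ (H\otimes (\delta_{H}\circ \eta_{H}))$. A weak Hopf algebra is a weak Hopf quasigroup whose magma $(H,\eta_H,\mu_H)$ is a monoid; that is, a monoid and comonoid $H$ satisfying (a1), (a2), (a3) and (a4): there is a morphism $\lambda_H:H\to H$ (the antipode) such that (a4-1) $\Pi_{H}^{L}=id_{H}\ast \lambda_{H}$; (a4-2) $\Pi_{H}^{R}=\lambda_{H}\ast id_{H}$; (a4-3) $\lambda_{H}\ast \Pi_{H}^{L}=\Pi_{H}^{R}\ast \lambda_{H}= \lambda_{H}$; (a4-4) $\mu_H\circ (\lambda_H\otimes \mu_H)\circ (\delta_H\otimes H)=\mu_{H}\circ (\Pi_{H}^{R}\otimes H)$; (a4-5)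 $\mu_H\circ (H\otimes \mu_H)\circ (H\otimes \lambda_H\otimes H)\circ (\delta_H\otimes H)=\mu_{H}\circ (\Pi_{H}^{L}\otimes H)$; (a4-6) $\mu_H\circ(\mu_H\otimes \lambda_H)\circ (H\otimes \delta_H)=\mu_{H}\circ (H\otimes \Pi_{H}^{L})$; (a4-7) $\mu_H\circ (\mu_H\otimes H)\circ (H\otimes \lambda_H\otimes H)\circ (H\otimes \delta_H)=\mu_{H}\circ (H\otimes \Pi_{H}^{R})$. (When $\mu_H$ is associative, (a4-4)-(a4-7) follow from (a4-1) and (a4-2).) For $\sigma\in\{L,R\}$ define $\Omega_{\sigma}^{1}=(\mu_H\otimes H)\circ (H\otimes \Pi_{H}^{\sigma}\otimes H)\circ (H\otimes \delta_H)$ and $\Omega_{\sigma}^{2}=(H\otimes \mu_H)\circ (H\otimes \Pi_{H}^{\sigma}\otimes H)\circ (\delta_H\otimes H)$. Under (a1)-(a3) these are idempotent endomorphisms of $H\otimes H$; for $\alpha\in\{1,2\}$, $H\times_\sigma^\alpha H$ with $q_{\sigma}^{\alpha}:H\otimes H\to H\times_\sigma^\alpha H$, $j_{\sigma}^{\alpha}:H\times_\sigma^\alpha H\to H\otimes H$ denotes a splitting: $j_{\sigma}^{\alpha}\circ q_{\sigma}^{\alpha}=\Omega_{\sigma}^{\alpha}$, $q_{\sigma}^{\alpha}\circ j_{\sigma}^{\alpha}=id$. The right and left Galois morphisms are $\beta=(\mu_H\otimes H)\circ (H\otimes \delta_H)$ and $\gamma=(H\otimes \mu_H)\circ (\delta_H\otimes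 H)$. *)

(* Defs.v *)
From mathcomp Require Import all_boot.

Set Implicit Arguments.
Unset Strict Implicit.
Unset Printing Implicit Defensive.

Declare Scope obj_scope.
Declare Scope mor_scope.
Delimit Scope obj_scope with obj.
Delimit Scope mor_scope with mor.

Reserved Notation "A ⊗ B" (at level 40, left associativity).
Reserved Notation "g ∘ f" (at level 50, left associativity).
Reserved Notation "f ≡ g" (at level 70, no associativity).

Record category := Category {
  obj :> Type;
  Hom : obj -> obj -> Type;
  idm : forall A, Hom A A;
  comp : forall A B D, Hom B D -> Hom A B -> Hom A D;
  comp_idl : forall A B (f : Hom A B), comp (idm B) f = f;
  comp_idr : forall A B (f : Hom A B), comp f (idm A) = f;
  compA : forall A B D E (h : Hom D E) (g : Hom B D) (f : Hom A B),
    comp h (comp g f) = comp (comp h g) f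
}.
Bind Scope obj_scope with obj.
Bind Scope mor_scope with Hom.
Arguments Hom {c} (A B)%_obj : rename.
Arguments idm {c} A%_obj : rename.
Arguments comp {c A B D} (g f)%_mor : rename.

(* Equality of arrows, domain and codomain included.  In a strict monoidal
   category two arrows are compared although their (co)domains, such as
   (A ⊗ B) ⊗ D and A ⊗ (B ⊗ D), are only propositionally equal. *)
Inductive mor_eq (C : category) (A B : C) (f : Hom A B) :
    forall A' B' : C, Hom A' B' -> Prop :=
  mor_refl : mor_eq f f.
Notation "f ≡ g" := (mor_eq f%mor g%mor) : type_scope.

Definition is_iso (C : category) (A B : C) (f : Hom A B) : Prop :=
  exists g : Hom B A, comp g f = idm A /\ comp f g = idm B.

Definition has_equalizers (C : category) : Prop :=
  forall (A B : C) (f g : Hom A B), exists (E : C) (e : Hom E A),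
    comp f e = comp g e /\
    forall (X : C) (h : Hom X A), comp f h = comp g h ->
      exists! k : Hom X E, comp e k = h.

Definition has_coequalizers (C : category) : Prop :=
  forall (A B : C) (f g : Hom A B), exists (Q : C) (q : Hom B Q),
    comp q f = comp q g /\
    forall (X : C) (h : Hom B X), comp h f = comp h g ->
      exists! k : Hom Q X, comp k q = h.

Record splitting (C : category) (A : C) (w : Hom A A) := Splitting {
  spl_obj : C;
  spl_q : Hom A spl_obj;
  spl_j : Hom spl_obj A;
  spl_jq : comp spl_j spl_q = w;
  spl_qj : comp spl_q spl_j = idm spl_obj
}.

Record strict_monoidal := StrictMonoidal {
  smc_cat :> category;
  munit : smc_cat;
  tenso : smc_cat -> smc_cat -> smc_cat;
  tensm : forall A B A' B' : smc_cat,
    Hom A B -> Hom A' B' -> Hom (tenso A A') (tenso B B');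
  tensm_id : forall A B : smc_cat,
    tensm (idm A) (idm B) = idm (tenso A B);
  tensm_comp : forall (A B D A' B' D' : smc_cat)
      (g : Hom B D) (f : Hom A B) (g' : Hom B' D') (f' : Hom A' B'),
    tensm (comp g f) (comp g' f') = comp (tensm g g') (tensm f f');
  tensoA : forall A B D : smc_cat,
    tenso A (tenso B D) = tenso (tenso A B) D;
  tens1o : forall A : smc_cat, tenso munit A = A;
  tenso1 : forall A : smc_cat, tenso A munit = A;
  tensmA : forall (A B A' B' A'' B'' : smc_cat)
      (f : Hom A B) (f' : Hom A' B') (f'' : Hom A'' B''),
    tensm f (tensm f' f'') ≡ tensm (tensm f f') f'';
  tens1m : forall (A B : smc_cat) (f : Hom A B),
    tensm (idm munit) f ≡ f;
  tensm1 : forall (A B : smc_cat) (f : Hom A B),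
    tensm f (idm munit) ≡ f
}.
Arguments munit {s} : rename.
Arguments tenso {s} (A B)%_obj : rename.
Arguments tensm {s A B A' B'} (f g)%_mor : rename.
Notation "A ⊗ B" := (tenso A%obj B%obj) : obj_scope.
Notation "f ⊗ g" := (tensm f%mor g%mor) : mor_scope.

(* Equality of objects, found by instance search from the strictness laws.
   Every use below is an identity between bracketings of the same tensor
   product, up to unit factors. *)
Class same_obj (C : category) (A B : C) : Prop := same_objP : A = B.

Ltac solve_same_obj :=
  rewrite /same_obj; first [exact: erefl | by rewrite !(tens1o, tenso1, tensoA)].
#[global] Hint Extern 0 (same_obj _ _) => solve_same_obj : typeclass_instances.

(* The arrow f, regarded as an arrow between objects equal to its own ones. *)
Definition recast (C : category) (A B A' B' : C)
    (eA : same_obj A A') (eB : same_obj B B') (f : Hom A B) : Hom A' B' :=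
  ecast X (Hom X B') eA (ecast Y (Hom A Y) eB f).
Arguments recast {C A B A' B' eA eB} f%_mor.

(* Composition of f : A -> B with g : B' -> D, where B and B' are equal
   objects; it is convertible to comp when B and B' are convertible. *)
Definition scomp (C : category) (A B B' D : C)
    (g : Hom B' D) (f : Hom A B) (e : same_obj B B') : Hom A D :=
  comp g (ecast X (Hom A X) e f).
Arguments scomp {C A B B' D} (g f)%_mor {e}.
Notation "g ∘ f" := (scomp g%mor f%mor) : mor_scope.

Record strict_braided := StrictBraided {
  sbc_smc :> strict_monoidal;
  braid : forall A B : sbc_smc, Hom (A ⊗ B) (B ⊗ A);
  braidV : forall A B : sbc_smc, Hom (B ⊗ A) (A ⊗ B);
  braidK : forall A B : sbc_smc, comp (braidV A B) (braid A B) = idm (A ⊗ B);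
  braidVK : forall A B : sbc_smc, comp (braid A B) (braidV A B) = idm (B ⊗ A);
  braid_nat : forall (A B A' B' : sbc_smc) (f : Hom A B) (f' : Hom A' B'),
    comp (braid B B') (f ⊗ f') = comp (f' ⊗ f) (braid A A');
  braid_tensr : forall A B D : sbc_smc,
    braid A (B ⊗ D) ≡ (idm B ⊗ braid A D) ∘ (braid A B ⊗ idm D);
  braid_tensl : forall A B D : sbc_smc,
    braid (A ⊗ B) D ≡ (braid A D ⊗ idm B) ∘ (idm A ⊗ braid B D)
}.
Arguments braid {s} (A B)%_obj : rename.
Arguments braidV {s} (A B)%_obj : rename.

Record monoid (C : strict_monoidal) (H : C) := Monoid {
  eta : Hom munit H;
  mu : Hom (H ⊗ H) H;
  mu_etal : mu ∘ (eta ⊗ idm H) ≡ idm H;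
  mu_etar : mu ∘ (idm H ⊗ eta) ≡ idm H;
  mu_assoc : mu ∘ (mu ⊗ idm H) ≡ mu ∘ (idm H ⊗ mu)
}.

Record comonoid (C : strict_monoidal) (H : C) := Comonoid {
  eps : Hom H munit;
  delta : Hom H (H ⊗ H);
  eps_deltal : (eps ⊗ idm H) ∘ delta ≡ idm H;
  eps_deltar : (idm H ⊗ eps) ∘ delta ≡ idm H;
  delta_coassoc : (delta ⊗ idm H) ∘ delta ≡ (idm H ⊗ delta) ∘ delta
}.

Section WeakHopf.
Context {C : strict_braided} {H : C} (M : monoid H) (D : comonoid H).
Local Open Scope mor_scope.
Local Notation η := (eta M).
Local Notation μ := (mu M).
Local Notation ε := (eps D).
Local Notation δ := (delta D).
Local Notation "1" := (idm H) : mor_scope.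
Local Notation c := (braid H H).
Local Notation cV := (braidV H H).

Definition delta2 : Hom (H ⊗ H) ((H ⊗ H) ⊗ (H ⊗ H)) :=
  recast ((1 ⊗ c ⊗ 1) ∘ (δ ⊗ δ)).

Definition conv (u v : Hom H H) : Hom H H := μ ∘ (u ⊗ v) ∘ δ.

Definition delta_mu_compat : Prop := δ ∘ μ = (μ ⊗ μ) ∘ delta2.

Definition weak_counit : Prop :=
  [/\ ε ∘ μ ∘ (μ ⊗ 1) ≡ ε ∘ μ ∘ (1 ⊗ μ),
      ε ∘ μ ∘ (1 ⊗ μ) ≡ ((ε ∘ μ) ⊗ (ε ∘ μ)) ∘ (1 ⊗ δ ⊗ 1)
    & ((ε ∘ μ) ⊗ (ε ∘ μ)) ∘ (1 ⊗ δ ⊗ 1)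
        ≡ ((ε ∘ μ) ⊗ (ε ∘ μ)) ∘ (1 ⊗ (cV ∘ δ) ⊗ 1)].

Definition weak_unit : Prop :=
  (δ ⊗ 1) ∘ δ ∘ η ≡ (1 ⊗ μ ⊗ 1) ∘ ((δ ∘ η) ⊗ (δ ∘ η)) /\
  (1 ⊗ μ ⊗ 1) ∘ ((δ ∘ η) ⊗ (δ ∘ η))
    ≡ (1 ⊗ (μ ∘ cV) ⊗ 1) ∘ ((δ ∘ η) ⊗ (δ ∘ η)).

Definition PiL : Hom H H :=
  recast (((ε ∘ μ) ⊗ 1) ∘ (1 ⊗ c) ∘ ((δ ∘ η) ⊗ 1)).

Definition PiR : Hom H H :=
  recast ((1 ⊗ (ε ∘ μ)) ∘ (c ⊗ 1) ∘ (1 ⊗ (δ ∘ η))).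

Record is_antipode (l : Hom H H) : Prop := IsAntipode {
  antipodeL : PiL = conv 1 l;
  antipodeR : PiR = conv l 1;
  antipode_PiL : conv l PiL = l;
  antipode_PiR : conv PiR l = l;
  antipode_mul1 : μ ∘ (l ⊗ μ) ∘ (δ ⊗ 1) ≡ μ ∘ (PiR ⊗ 1);
  antipode_mul2 : μ ∘ (1 ⊗ μ) ∘ (1 ⊗ l ⊗ 1) ∘ (δ ⊗ 1) ≡ μ ∘ (PiL ⊗ 1);
  antipode_mul3 : μ ∘ (μ ⊗ l) ∘ (1 ⊗ δ) ≡ μ ∘ (1 ⊗ PiL);
  antipode_mul4 : μ ∘ (μ ⊗ 1) ∘ (1 ⊗ l ⊗ 1) ∘ (1 ⊗ δ) ≡ μ ∘ (1 ⊗ PiR)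
}.

Definition weak_hopf_algebra : Prop :=
  [/\ delta_mu_compat, weak_counit, weak_unit
    & exists l : Hom H H, is_antipode l].

Definition Omega1 (P : Hom H H) : Hom (H ⊗ H) (H ⊗ H) :=
  (μ ⊗ 1) ∘ (1 ⊗ P ⊗ 1) ∘ (1 ⊗ δ).

Definition Omega2 (P : Hom H H) : Hom (H ⊗ H) (H ⊗ H) :=
  (1 ⊗ μ) ∘ (1 ⊗ P ⊗ 1) ∘ (δ ⊗ 1).

Definition galois_beta : Hom (H ⊗ H) (H ⊗ H) := (μ ⊗ 1) ∘ (1 ⊗ δ).

Definition galois_gamma : Hom (H ⊗ H) (H ⊗ H) := (1 ⊗ μ) ∘ (δ ⊗ 1).

End WeakHopf.

(* Main.v *)
Require Import Defs.
From mathcomp Require Import all_boot.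
From Stdlib Require Import ProofIrrelevance.

(** For an endomorphism [u] of [H] put
      [G(u) = (mu ⊗ 1) (1 ⊗ u ⊗ 1) (1 ⊗ delta)],
    that is, [x ⊗ y |-> x u(y_1) ⊗ y_2].  Then [G(id)] is the right Galois
    morphism and [G(Pi)] is the idempotent [Omega^1] attached to [Pi], so that
    (i) and (ii) are two readings of one statement about [G]:

    - [G(u) G(v) = G(v * u)] by associativity and coassociativity
      ([gal_hconv]), and [G] is injective ([gal_inj]);
    - the image of [G] consists of all endomorphisms of [H ⊗ H] that are left
      [H]-linear and right [H]-colinear ([gal_linear], [gal_colinear],
      [gal_onto]);
    - [PiL * id = id] and [id * PiR = id]: both unfold to the statement that
      multiplying by the unit, comultiplying the product by (a1) and applying
      the counit to one factor changes nothing ([hconv_hPiL]).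

    By the last point, [G(id)] absorbs [Omega_L^1] on the right and
    [Omega_R^1] on the left, and [f] is invertible exactly when [G(id)] has a
    relative inverse: some [b] with [b G(id) = Omega_L^1],
    [G(id) b = Omega_R^1] and [Omega_L^1 b = b = b Omega_R^1] ([split_iso]).
    Such a [b] inherits linearity and colinearity from [G(id)], as the inverse
    of a linear map does ([gal_rel_inverse]); hence [b = G(l)], and the
    conditions on [b] become [id * l = PiL], [l * id = PiR], [l * PiL = l = PiR * l].  These are
    the convolution axioms of an antipode, and the remaining four axioms follow
    from them by associativity ([is_antipodeP]).

    The equivalence of (i) and (iii) is the same theorem in the category with
    reversed tensor product: there the left Galois morphism, [Omega^2] and
    [PiR] play the parts of the right one, [Omega^1] and [PiL], and the factors
    of a convolution are exchanged.

    Only tensor powers of [H] occur, so the computations take place between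
    the objects [H^n], where the two whiskerings [1 ⊗ f] and [f ⊗ 1] of an
    arrow [H^n -> H^m] have literally the same source and target; bracketing
    never has to be tracked there. *)

Set Implicit Arguments.
Unset Strict Implicit.
Unset Printing Implicit Defensive.

(** * Equality of arrows between equal objects *)

Section MorEq.
Variable C : category.

(** Between fixed objects the relation is equality.  Its index includes the
    objects, whose equality proofs are arbitrary, so uniqueness of these
    proofs is what makes this true. *)
Lemma mor_eq_eq (A B : C) (f g : Hom A B) : f ≡ g -> f = g.
Proof.
suff gen A' B' (g' : Hom A' B') (e : f ≡ g') (eA : A' = A) (eB : B' = B) :
    f = ecast X (Hom X B) eA (ecast Y (Hom A' Y) eB g').
  by move=> e; exact: (gen _ _ g e erefl erefl).
case: e eA eB => eA eB.
by rewrite (proof_irrelevance _ eA erefl) (proof_irrelevance _ eB erefl).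
Qed.

Lemma mor_eq_sym (A B A' B' : C) (f : Hom A B) (g : Hom A' B') :
  f ≡ g -> g ≡ f.
Proof. by case. Qed.

Lemma mor_eq_trans (A B A' B' A'' B'' : C)
    (f : Hom A B) (g : Hom A' B') (h : Hom A'' B'') :
  f ≡ g -> g ≡ h -> f ≡ h.
Proof. by move=> fg; case. Qed.

Lemma recast_mor_eq (A B A' B' : C) (f : Hom A B)
    (eA : same_obj A A') (eB : same_obj B B') :
  @recast C A B A' B' eA eB f ≡ f.
Proof. by rewrite /recast; case: _ / eB; case: _ / eA. Qed.

Lemma scomp_mor_eq (A B B' D A1 B1 B1' D1 : C)
    (g : Hom B' D) (f : Hom A B) (e : same_obj B B')
    (g1 : Hom B1' D1) (f1 : Hom A1 B1) (e1 : same_obj B1 B1') :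
  g ≡ g1 -> f ≡ f1 -> @scomp C A B B' D g f e ≡ @scomp C A1 B1 B1' D1 g1 f1 e1.
Proof.
move=> gg1 ff1; case: gg1 e1 => e1; case: ff1 e1 => e1.
by rewrite (proof_irrelevance _ e e1).
Qed.

Lemma comp_scomp_mor_eq (A B D A1 B1 B1' D1 : C) (g : Hom B D) (f : Hom A B)
    (g1 : Hom B1' D1) (f1 : Hom A1 B1) (e1 : same_obj B1 B1') :
  g ≡ g1 -> f ≡ f1 -> Defs.comp g f ≡ @scomp C A1 B1 B1' D1 g1 f1 e1.
Proof. exact: (@scomp_mor_eq _ _ _ _ _ _ _ _ _ _ erefl). Qed.
Arguments comp_scomp_mor_eq {A B D A1 B1 B1' D1 g f g1 f1} e1.

Lemma comp_mor_eq (A B D A1 B1 D1 : C) (g : Hom B D) (f : Hom A B)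
    (g1 : Hom B1 D1) (f1 : Hom A1 B1) :
  g ≡ g1 -> f ≡ f1 -> Defs.comp g f ≡ Defs.comp g1 f1.
Proof. exact: (comp_scomp_mor_eq erefl). Qed.

(** Between the splittings of [p] and [r], invertibility of the arrow induced
    by [b] amounts to the existence of an inverse of [b] relative to [p] and
    [r]. *)
Lemma split_iso (A X Y : C) (b p r : Hom A A) (qp : Hom A X) (jp : Hom X A)
    (qr : Hom A Y) (jr : Hom Y A) :
    Defs.comp jp qp = p -> Defs.comp qp jp = idm X ->
    Defs.comp jr qr = r -> Defs.comp qr jr = idm Y ->
    Defs.comp b p = b -> Defs.comp r b = b ->
  is_iso (Defs.comp (Defs.comp qr b) jp) <->
  exists b', [/\ Defs.comp b' b = p, Defs.comp b b' = r,
                 Defs.comp p b' = b' & Defs.comp b' r = b'].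
Proof.
move=> jqp qjp jqr qjr bp rb; split=> [[k [kf fk]]|[b' [b'b bb' pb' b'r]]].
  exists (Defs.comp (Defs.comp jp k) qr); split.
  - by rewrite -bp -jqp -[in RHS](comp_idl qp) -kf !Defs.compA.
  - by rewrite -[in LHS]rb -jqr -[in RHS](comp_idl qr) -fk !Defs.compA.
  - by rewrite -jqp -!Defs.compA (Defs.compA qp) qjp comp_idl.
  - by rewrite -jqr -!Defs.compA (Defs.compA qr) qjr comp_idl.
exists (Defs.comp (Defs.comp qp b') jr); split.
  rewrite -!Defs.compA (Defs.compA jr) jqr (Defs.compA r) rb (Defs.compA b') b'b.
  by rewrite -jqp -Defs.compA qjp comp_idr qjp.
rewrite -!Defs.compA (Defs.compA jp) jqp (Defs.compA p) pb' (Defs.compA b) bb'.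
by rewrite -jqr -Defs.compA qjr comp_idr qjr.
Qed.

End MorEq.

Lemma tensm_mor_eq (C : strict_monoidal) (A B A' B' A1 B1 A1' B1' : C)
    (f : Hom A B) (g : Hom A' B') (f1 : Hom A1 B1) (g1 : Hom A1' B1') :
  f ≡ f1 -> g ≡ g1 -> f ⊗ g ≡ f1 ⊗ g1.
Proof. by case; case. Qed.

(** * Whiskering on tensor powers *)

Section Powers.
Variables (C : strict_monoidal) (H : C).
Local Open Scope mor_scope.

(** Without a trailing unit factor, so that [tpow 1] and [tpow 2] are
    convertible to [H] and [H ⊗ H]. *)
Fixpoint tpow (n : nat) : C :=
  if n is n'.+1 then (if n' is 0 then H else (H ⊗ tpow n')%obj) else munit.
Arguments tpow : simpl never.

Lemma tpowS n : (H ⊗ tpow n)%obj = tpow n.+1.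
Proof. by case: n => [|n] //; rewrite /tpow tenso1. Qed.

Lemma tpowSr n : (tpow n ⊗ H)%obj = tpow n.+1.
Proof.
elim: n => [|[|n] IHn].
- exact: tens1o.
- by [].
by rewrite -[tpow n.+3]tpowS -[in RHS]IHn tensoA.
Qed.

Definition hom n m := Hom (tpow n) (tpow m).
Definition hid n : hom n n := idm (tpow n).
Definition hcomp n m p (g : hom m p) (f : hom n m) : hom n p := Defs.comp g f.
Definition lwhisk n m (f : hom n m) : hom n.+1 m.+1 :=
  @recast C _ _ _ _ (tpowS n) (tpowS m) (idm H ⊗ f).
Definition rwhisk n m (f : hom n m) : hom n.+1 m.+1 :=
  @recast C _ _ _ _ (tpowSr n) (tpowSr m) (f ⊗ idm H).

Local Notation "g • f" := (hcomp g f) (at level 50, left associativity).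

Lemma lwhiskE n m (f : hom n m) : lwhisk f ≡ idm H ⊗ f.
Proof. exact: recast_mor_eq. Qed.

Lemma rwhiskE n m (f : hom n m) : rwhisk f ≡ f ⊗ idm H.
Proof. exact: recast_mor_eq. Qed.

Lemma hcompA n m p q (h : hom p q) (g : hom m p) (f : hom n m) :
  h • (g • f) = h • g • f.
Proof. exact: Defs.compA. Qed.

Lemma hcomp1f n m (f : hom n m) : hid m • f = f.
Proof. exact: comp_idl. Qed.

Lemma hcompf1 n m (f : hom n m) : f • hid n = f.
Proof. exact: comp_idr. Qed.

Lemma idm_mor_eq (A B : C) : A = B -> idm A ≡ idm B.
Proof. by move=> ->. Qed.

Lemma lwhisk1 n : lwhisk (hid n) = hid n.+1.
Proof.
apply: mor_eq_eq; apply: mor_eq_trans (lwhiskE _) _.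
by rewrite tensm_id; apply: idm_mor_eq; exact: tpowS.
Qed.

Lemma rwhisk1 n : rwhisk (hid n) = hid n.+1.
Proof.
apply: mor_eq_eq; apply: mor_eq_trans (rwhiskE _) _.
by rewrite tensm_id; apply: idm_mor_eq; exact: tpowSr.
Qed.

Lemma lwhiskM n m p (g : hom m p) (f : hom n m) :
  lwhisk (g • f) = lwhisk g • lwhisk f.
Proof.
apply: mor_eq_eq; apply: mor_eq_trans (lwhiskE _) _; apply: mor_eq_sym.
apply: mor_eq_trans (comp_mor_eq (lwhiskE _) (lwhiskE _)) _.
by rewrite -tensm_comp comp_idl.
Qed.

Lemma rwhiskM n m p (g : hom m p) (f : hom n m) :
  rwhisk (g • f) = rwhisk g • rwhisk f.
Proof.
apply: mor_eq_eq; apply: mor_eq_trans (rwhiskE _) _; apply: mor_eq_sym.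
apply: mor_eq_trans (comp_mor_eq (rwhiskE _) (rwhiskE _)) _.
by rewrite -tensm_comp comp_idl.
Qed.

(** Strict associativity of the tensor product, as an equation between arrows
    of the same type for every [n] and [m]. *)
Lemma rwhisk_lwhisk n m (f : hom n m) : rwhisk (lwhisk f) = lwhisk (rwhisk f).
Proof.
apply: mor_eq_eq; apply: mor_eq_trans (rwhiskE _) _.
apply: mor_eq_trans (tensm_mor_eq (lwhiskE _) (mor_refl _)) _.
apply: mor_eq_sym; apply: mor_eq_trans (lwhiskE _) _.
apply: mor_eq_trans (tensm_mor_eq (mor_refl _) (rwhiskE _)) _.
exact: tensmA.
Qed.

Lemma lwhisk_tens n p q k l (F : hom p q) (g : hom k l) :
  F ≡ idm (tpow n) ⊗ g -> lwhisk F ≡ idm (tpow n.+1) ⊗ g.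
Proof.
move=> FE; apply: mor_eq_trans (lwhiskE _) _.
apply: mor_eq_trans (tensm_mor_eq (mor_refl _) FE) _.
apply: mor_eq_trans (tensmA _ _ _) _; apply: tensm_mor_eq => //.
by rewrite tensm_id; apply: idm_mor_eq; exact: tpowS.
Qed.

Lemma rwhisk_tens k p q n m (F : hom p q) (f : hom n m) :
  F ≡ f ⊗ idm (tpow k) -> rwhisk F ≡ f ⊗ idm (tpow k.+1).
Proof.
move=> FE; apply: mor_eq_trans (rwhiskE _) _.
apply: mor_eq_trans (tensm_mor_eq FE (mor_refl _)) _.
apply: mor_eq_trans (mor_eq_sym (tensmA _ _ _)) _; apply: tensm_mor_eq => //.
by rewrite tensm_id; apply: idm_mor_eq; exact: tpowSr.
Qed.

(** The interchange law for [f] and [g] acting on disjoint strands.  The four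
    whiskered arrows are described up to bracketing, because their types agree
    only once the arities are numerals. *)
Lemma exchange n m k l p q r s (f : hom n m) (g : hom k l)
    (fl : hom p q) (ng : hom r p) (mg : hom s q) (fk : hom r s) :
  fl ≡ f ⊗ idm (tpow l) -> ng ≡ idm (tpow n) ⊗ g ->
  mg ≡ idm (tpow m) ⊗ g -> fk ≡ f ⊗ idm (tpow k) ->
  fl • ng = mg • fk.
Proof.
move=> flE ngE mgE fkE; apply: mor_eq_eq.
apply: mor_eq_trans (comp_mor_eq flE ngE) _.
apply: mor_eq_sym; apply: mor_eq_trans (comp_mor_eq mgE fkE) _.
by rewrite -!tensm_comp !comp_idl !comp_idr.
Qed.

(* Compositions are kept associated to the left; [hcomp_square] rewrites a
   pair of factors preceded by others. *)
Lemma hcomp_square n m m' p (a : hom m p) (b : hom n m) (c : hom m' p)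
    (d : hom n m') :
  a • b = c • d -> forall q (x : hom p q), x • a • b = x • c • d.
Proof. by move=> E q x; rewrite -!hcompA E. Qed.

Lemma hcomp_cancel n m (a : hom m n) (b : hom n m) :
  a • b = hid n -> forall q (x : hom n q), x • a • b = x.
Proof. by move=> E q x; rewrite -hcompA E hcompf1. Qed.

Lemma lwhisk_square n m m' p (a : hom m p) (b : hom n m) (c : hom m' p)
    (d : hom n m') :
  a • b = c • d -> lwhisk a • lwhisk b = lwhisk c • lwhisk d.
Proof. by move=> E; rewrite -!lwhiskM E. Qed.

Lemma rwhisk_square n m m' p (a : hom m p) (b : hom n m) (c : hom m' p)
    (d : hom n m') :
  a • b = c • d -> rwhisk a • rwhisk b = rwhisk c • rwhisk d.
Proof. by move=> E; rewrite -!rwhiskM E. Qed.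

End Powers.
Arguments tpow : simpl never.
Notation "g • f" := (hcomp g f) (at level 50, left associativity).

Lemma whisk0l (C : strict_monoidal) (H : C) k l (g : hom H k l) :
  g ≡ (idm (tpow H 0) ⊗ g)%mor.
Proof. exact: mor_eq_sym (tens1m _). Qed.
Lemma whisk0r (C : strict_monoidal) (H : C) k l (g : hom H k l) :
  g ≡ (g ⊗ idm (tpow H 0))%mor.
Proof. exact: mor_eq_sym (tensm1 _). Qed.

Ltac whiskered :=
  repeat first [ exact: whisk0l | exact: whisk0r
               | apply: lwhisk_tens | apply: rwhisk_tens ].

(* Closes an instance of the interchange law in which [f] stands to the left
   of [g]. *)
Ltac slide f g := apply: (exchange (f := f) (g := g)); whiskered.

(** * Convolution and Galois morphisms *)

Section Galois.
Variables (C : strict_monoidal) (H : C) (M : monoid H) (D : comonoid H).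
Local Notation hom := (hom H).
Local Notation L := (@lwhisk C H _ _).
Local Notation R := (@rwhisk C H _ _).

Definition hmu : hom 2 1 := mu M.
Definition heta : hom 0 1 := eta M.
Definition hdelta : hom 1 2 := delta D.
Definition heps : hom 1 0 := eps D.
Local Notation μ := hmu.
Local Notation δ := hdelta.
Local Notation η := heta.
Local Notation ε := heps.

Let wE := (lwhiskM, rwhiskM, rwhisk_lwhisk, hcompA).

Lemma hmu_assoc : μ • R μ = μ • L μ.
Proof.
apply: mor_eq_eq; apply: (mor_eq_trans (g := mu M ∘ (mu M ⊗ idm H))).
  exact: (comp_scomp_mor_eq _ (mor_refl _) (rwhiskE _)).
apply: mor_eq_trans (mu_assoc M) _; apply: mor_eq_sym.
exact: (comp_scomp_mor_eq _ (mor_refl _) (lwhiskE _)).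
Qed.

Lemma hmu_etal : μ • R η = hid H 1.
Proof.
apply: mor_eq_eq; apply: mor_eq_trans (mu_etal M).
exact: (comp_scomp_mor_eq _ (mor_refl _) (rwhiskE _)).
Qed.

Lemma hmu_etar : μ • L η = hid H 1.
Proof.
apply: mor_eq_eq; apply: mor_eq_trans (mu_etar M).
exact: (comp_scomp_mor_eq _ (mor_refl _) (lwhiskE _)).
Qed.

Lemma hdelta_coassoc : R δ • δ = L δ • δ.
Proof.
apply: mor_eq_eq; apply: (mor_eq_trans (g := (delta D ⊗ idm H) ∘ delta D)).
  exact: (comp_scomp_mor_eq _ (rwhiskE _) (mor_refl _)).
apply: mor_eq_trans (delta_coassoc D) _; apply: mor_eq_sym.
exact: (comp_scomp_mor_eq _ (lwhiskE _) (mor_refl _)).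
Qed.

Lemma heps_deltal : R ε • δ = hid H 1.
Proof.
apply: mor_eq_eq; apply: mor_eq_trans (eps_deltal D).
exact: (comp_scomp_mor_eq _ (rwhiskE _) (mor_refl _)).
Qed.

Lemma heps_deltar : L ε • δ = hid H 1.
Proof.
apply: mor_eq_eq; apply: mor_eq_trans (eps_deltar D).
exact: (comp_scomp_mor_eq _ (lwhiskE _) (mor_refl _)).
Qed.

Definition hconv (u v : hom 1 1) : hom 1 1 := μ • L v • R u • δ.

(** On elements, [x ⊗ y |-> x u(y_1) ⊗ y_2]. *)
Definition gal (u : hom 1 1) : hom 2 2 := R μ • L (R u) • L δ.

Let Rassoc : R μ • R (R μ) = R μ • L (R μ).
Proof. by rewrite -rwhisk_lwhisk -!rwhiskM hmu_assoc. Qed.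

Let Lcoassoc : L (L δ) • L δ = L (R δ) • L δ.
Proof. by rewrite -!lwhiskM hdelta_coassoc. Qed.

Lemma gal_hconv u v : gal u • gal v = gal (hconv v u).
Proof.
rewrite /gal /hconv !wE.
have E1 : L δ • R μ = R (R μ) • L (L δ) by symmetry; slide μ δ.
have E2 : L δ • R v = R (R v) • L δ by symmetry; slide v δ.
have E3 : L u • R μ = R μ • L (L u) by symmetry; slide μ u.
have := rwhisk_square E3; rewrite !wE => {}E3.
rewrite (hcomp_square E1) (hcomp_square E3).
rewrite (hcomp_square (lwhisk_square E2)).
by rewrite Rassoc (hcomp_square Lcoassoc).
Qed.

(* [R μ] is the left action of [H] on [H ⊗ H], and [L δ] the right coaction. *)
Lemma gal_linear u : gal u • R μ = R μ • L (gal u).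
Proof.
rewrite /gal !wE.
have E1 : L δ • R μ = R (R μ) • L (L δ) by symmetry; slide μ δ.
have E3 : L u • R μ = R μ • L (L u) by symmetry; slide μ u.
have := rwhisk_square E3; rewrite !wE => {}E3.
by rewrite (hcomp_square E1) (hcomp_square E3) Rassoc.
Qed.

Lemma gal_colinear u : L δ • gal u = R (gal u) • L δ.
Proof.
rewrite /gal !wE.
have E1 : L δ • R μ = R (R μ) • L (L δ) by symmetry; slide μ δ.
have E2 : L δ • R u = R (R u) • L δ by symmetry; slide u δ.
by rewrite E1 (hcomp_square (lwhisk_square E2)) (hcomp_square Lcoassoc).
Qed.

(** By linearity [F] is determined on [1 ⊗ y], and by colinearity from
    [(1 ⊗ eps) F]; the endomorphism so obtained is [y |-> (1 ⊗ eps) F (1 ⊗ y)]. *)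
Lemma gal_onto F : F • R μ = R μ • L F -> L δ • F = R F • L δ ->
  F = gal (L ε • F • R η).
Proof.
move=> Flin Fcolin; rewrite /gal !wE.
have E1 : L δ • R η = R (R η) • δ by symmetry; slide η δ.
rewrite -(hcomp_square (lwhisk_square E1)) -(hcomp_square (lwhisk_square Fcolin)).
have E2 : L (L (R ε)) • L (L δ) = hid H 3.
  by rewrite -!lwhiskM heps_deltal !lwhisk1.
rewrite (hcomp_cancel E2) -Flin; apply/esym/hcomp_cancel.
by rewrite -rwhisk_lwhisk -rwhiskM hmu_etar rwhisk1.
Qed.

Lemma gal_counit u : L ε • gal u • R η = u.
Proof.
rewrite /gal !hcompA.
have E1 : L ε • R μ = μ • L (L ε) by symmetry; slide μ ε.
have E2 : L δ • R η = R (R η) • δ by symmetry; slide η δ.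
have E3 : L u • R η = R η • u by symmetry; slide η u.
have E4 : L (L ε) • R (R η) = R η • L ε by symmetry; slide η (L ε).
have E5 : L ε • R u = u • L ε by symmetry; slide u ε.
have := rwhisk_square E3; rewrite rwhisk_lwhisk => {}E3.
rewrite E1 (hcomp_square E2) (hcomp_square E3) (hcomp_square E4) hmu_etal hcomp1f.
rewrite E5; exact: (hcomp_cancel heps_deltar).
Qed.

Lemma gal_inj : injective gal.
Proof. by move=> u v uv; rewrite -[u]gal_counit uv gal_counit. Qed.

(** A relative inverse of a linear arrow is linear: writing [m] for the action
    and [b = b (u b)], one moves [u b] past [m], then [u] back, which leaves
    [b u m b = p m b = m p b = m b].  Colinearity is dual. *)
Lemma gal_rel_inverse u p r (b : hom 2 2) :
  b • gal u = gal p -> gal u • b = gal r -> gal p • b = b -> b • gal r = b ->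
  exists l, b = gal l.
Proof.
move=> bu ub pb br; exists (L ε • b • R η); apply: gal_onto.
  rewrite -[in LHS]br -hcompA gal_linear -ub lwhiskM !hcompA.
  by rewrite -(hcomp_square (gal_linear _)) bu gal_linear -hcompA -lwhiskM pb.
rewrite -[in LHS]pb hcompA gal_colinear -bu rwhiskM.
rewrite -(hcomp_square (gal_colinear _)) -hcompA ub.
by rewrite (hcomp_square (gal_colinear _)) -rwhiskM br.
Qed.

(** Under [P * id = id] and [id * Q = id], invertibility of the arrow that
    [gal id] induces between the splittings of [gal P] and [gal Q] is the
    existence of an antipode-like convolution inverse. *)
Lemma gal_iso P Q (X Y : C) (qP : Hom (H ⊗ H) X) (jP : Hom X (H ⊗ H))
    (qQ : Hom (H ⊗ H) Y) (jQ : Hom Y (H ⊗ H)) :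
    hconv P (hid H 1) = hid H 1 -> hconv (hid H 1) Q = hid H 1 ->
    Defs.comp jP qP = gal P -> Defs.comp qP jP = idm X ->
    Defs.comp jQ qQ = gal Q -> Defs.comp qQ jQ = idm Y ->
  is_iso (Defs.comp (Defs.comp qQ (gal (hid H 1))) jP) <->
  exists l, [/\ hconv (hid H 1) l = P, hconv l (hid H 1) = Q,
                hconv l P = l & hconv Q l = l].
Proof.
move=> P1 Q1 jqP qjP jqQ qjQ.
have βP : gal (hid H 1) • gal P = gal (hid H 1) by rewrite gal_hconv P1.
have Qβ : gal Q • gal (hid H 1) = gal (hid H 1) by rewrite gal_hconv Q1.
apply: (iff_trans (split_iso jqP qjP jqQ qjQ βP Qβ)).
split=> [[b [bu ub pb br]]|[l [idl lid lP Ql]]].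
  have [l bE] := gal_rel_inverse bu ub pb br.
  exists l; rewrite bE in bu ub pb br.
  by split; apply: gal_inj; rewrite -gal_hconv.
exists (gal l); rewrite -!/(gal _ • gal _) !gal_hconv.
by rewrite idl lid lP Ql.
Qed.

Definition hdelta_mu (c : hom 2 2) : Prop :=
  δ • μ = R μ • L (L μ) • L (R c) • R (R δ) • L δ.

(** The formula of [PiL] with an arbitrary arrow [c] in place of the braiding,
    so that it makes sense in any strict monoidal category; in the reversed
    one, with [c] the same braiding, it gives [PiR]. *)
Definition hPiL (c : hom 2 2) : hom 1 1 := R (ε • μ) • L c • R (δ • η).

(** Both sides equal [(eps ⊗ 1) delta mu (eta ⊗ 1)]: the left one after
    replacing [delta mu] by its expression in [c]. *)
Lemma hconv_hPiL c : hdelta_mu c -> hconv (hPiL c) (hid H 1) = hid H 1.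
Proof.
move=> compat; rewrite /hconv /hPiL lwhisk1 hcompf1 !wE.
have E1 : L δ • R η = R (R η) • δ by symmetry; slide η δ.
have E2 : R (ε • μ) • L (L μ) = μ • R (R (ε • μ)) by slide (ε • μ) μ.
transitivity (R ε • (δ • μ) • R η).
  rewrite compat !hcompA (hcomp_square E1).
  by rewrite -(rwhiskM ε μ) E2 !wE.
by rewrite hcompA heps_deltal hcomp1f hmu_etal.
Qed.

Lemma mul_hconvr u : μ • (L μ • R (R u)) • R δ = μ • R (hconv u (hid H 1)).
Proof.
by rewrite /hconv lwhisk1 hcompf1 !wE -hmu_assoc.
Qed.

Lemma mul_hconvl u : μ • L μ • R (L u) • R δ = μ • R (hconv (hid H 1) u).
Proof.
by rewrite /hconv rwhisk1 hcompf1 !wE -hmu_assoc.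
Qed.

End Galois.

(** * The reversed tensor product *)

Section Reverse.
Variable C : strict_monoidal.

Definition reverse : strict_monoidal :=
  @StrictMonoidal C munit (fun A B => (B ⊗ A)%obj)
    (fun A B A' B' f g => (g ⊗ f)%mor)
    (fun A B => tensm_id B A)
    (fun A B D A' B' D' g f g' f' => tensm_comp g' f' g f)
    (fun A B D => esym (tensoA D B A))
    (fun A => tenso1 A) (fun A => tens1o A)
    (fun A B A' B' A'' B'' f f' f'' => mor_eq_sym (tensmA f'' f' f))
    (fun A B f => tensm1 f) (fun A B f => tens1m f).

Variable H : C.

Definition reverse_monoid (M : monoid H) : @monoid reverse H.
Proof.
apply: (@Defs.Monoid reverse H (eta M) (mu M)).
- apply: (mor_eq_trans (g := mu M ∘ (idm H ⊗ eta M))) (mu_etar M).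
  exact: scomp_mor_eq.
- apply: (mor_eq_trans (g := mu M ∘ (eta M ⊗ idm H))) (mu_etal M).
  exact: scomp_mor_eq.
- apply: (mor_eq_trans (g := mu M ∘ (idm H ⊗ mu M))); first exact: scomp_mor_eq.
  apply: mor_eq_trans (mor_eq_sym (mu_assoc M)) _.
  exact: scomp_mor_eq.
Defined.

Definition reverse_comonoid (D : comonoid H) : @comonoid reverse H.
Proof.
apply: (@Defs.Comonoid reverse H (eps D) (delta D)).
- apply: (mor_eq_trans (g := (idm H ⊗ eps D) ∘ delta D)) (eps_deltar D).
  exact: scomp_mor_eq.
- apply: (mor_eq_trans (g := (eps D ⊗ idm H) ∘ delta D)) (eps_deltal D).
  exact: scomp_mor_eq.
- apply: (mor_eq_trans (g := (idm H ⊗ delta D) ∘ delta D)); first exact: scomp_mor_eq.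
  apply: mor_eq_trans (mor_eq_sym (delta_coassoc D)) _.
  exact: scomp_mor_eq.
Defined.

End Reverse.

(** * Translation of the defining expressions *)

Lemma hcomp_tensl (C : strict_monoidal) (H : C) a b a' b' n m p (f : hom H a b)
    (g : hom H a' b') (F : hom H m p) (G : hom H n m) :
  F ≡ (idm (tpow H b) ⊗ g)%mor -> G ≡ (f ⊗ idm (tpow H a'))%mor -> F • G ≡ (f ⊗ g)%mor.
Proof.
move=> FE GE; apply: mor_eq_trans (comp_mor_eq FE GE) _.
by rewrite -tensm_comp comp_idl comp_idr.
Qed.

Lemma hcomp_tensr (C : strict_monoidal) (H : C) a b a' b' n m p (f : hom H a b)
    (g : hom H a' b') (F : hom H m p) (G : hom H n m) :
  F ≡ (f ⊗ idm (tpow H b'))%mor -> G ≡ (idm (tpow H a) ⊗ g)%mor -> F • G ≡ (f ⊗ g)%mor.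
Proof.
move=> FE GE; apply: mor_eq_trans (comp_mor_eq FE GE) _.
by rewrite -tensm_comp comp_idl comp_idr.
Qed.

Lemma hcomp_scomp (C : strict_monoidal) (H : C) n m p (g : hom H m p)
    (f : hom H n m) (A B B' D : C) (g' : Hom B' D) (f' : Hom A B) (e : same_obj B B') :
  g ≡ g' -> f ≡ f' -> g • f ≡ @scomp C A B B' D g' f' e.
Proof. exact: comp_scomp_mor_eq. Qed.

Lemma lwhisk_tensm (C : strict_monoidal) (H : C) n m (f : hom H n m)
    (A B : C) (g : Hom A B) :
  f ≡ g -> lwhisk f ≡ (idm H ⊗ g)%mor.
Proof. move=> fg; apply: mor_eq_trans (lwhiskE _) _; exact: tensm_mor_eq. Qed.

Lemma rwhisk_tensm (C : strict_monoidal) (H : C) n m (f : hom H n m)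
    (A B : C) (g : Hom A B) :
  f ≡ g -> rwhisk f ≡ (g ⊗ idm H)%mor.
Proof. move=> fg; apply: mor_eq_trans (rwhiskE _) _; exact: tensm_mor_eq. Qed.

(* [translate] compares a composition of whiskerings with an expression of the
   same shape written with tensor products.  The arguments are passed
   explicitly because an object [tpow n] does not determine [n] by unification
   with [H ⊗ H]. *)
Ltac translate1 := lazymatch goal with
    | |- @mor_eq _ _ _ (@hcomp ?C ?H ?n ?m ?p ?g ?f) _ _ _ =>
        apply: (@hcomp_scomp C H n m p g f)
    | |- @mor_eq _ _ _ (@lwhisk ?C ?H ?n ?m ?f) _ _ _ => apply: (@lwhisk_tensm C H n m f)
    | |- @mor_eq _ _ _ (@rwhisk ?C ?H ?n ?m ?f) _ _ _ => apply: (@rwhisk_tensm C H n m f)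
    end.
Ltac translate := repeat first [ exact: mor_refl | translate1 ].

Section Translation.
Variables (C : strict_braided) (H : C) (M : monoid H) (D : comonoid H).
Local Open Scope mor_scope.
Local Notation μ := (mu M).
Local Notation δ := (delta D).
Local Notation M' := (reverse_monoid M).
Local Notation D' := (reverse_comonoid D).

Lemma Omega1E u : Omega1 M D u = gal M D u.
Proof.
apply: mor_eq_eq; apply: mor_eq_sym; rewrite /Omega1 /gal -rwhisk_lwhisk; translate.
Qed.

(* The reversed category has [A ⊗ B] for [B ⊗ A]; in particular its [gal] is
   [(1 ⊗ mu) (1 ⊗ u ⊗ 1) (delta ⊗ 1)] here. *)
Lemma Omega2E u : Omega2 M D u = gal M' D' u.
Proof.
apply: mor_eq_eq; apply: mor_eq_sym; rewrite /Omega2 /gal; translate.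
Qed.

Lemma betaE : galois_beta M D = gal M D (idm H).
Proof.
apply: mor_eq_eq; apply: mor_eq_sym.
rewrite /gal -[idm H]/(hid H 1) rwhisk1 lwhisk1 hcompf1 /galois_beta; translate.
Qed.

Lemma gammaE : galois_gamma M D = gal M' D' (idm H).
Proof.
apply: mor_eq_eq; apply: mor_eq_sym.
rewrite /gal -[idm H]/(hid (H : reverse C) 1) rwhisk1 lwhisk1 hcompf1.
by rewrite /galois_gamma; translate.
Qed.

Lemma convE u v : conv M D u v = hconv M D u v.
Proof.
apply: mor_eq_eq; apply: mor_eq_sym; rewrite /hconv /conv.
rewrite -[_ • lwhisk _ • rwhisk _]hcompA.
translate; apply: (hcomp_tensl (f := u : hom H 1 1) (g := v : hom H 1 1)); whiskered.
Qed.

Lemma conv_reverse u v : conv M D u v = hconv M' D' v u.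
Proof.
apply: mor_eq_eq; apply: mor_eq_sym; rewrite /hconv /conv.
rewrite -[_ • lwhisk _ • rwhisk _]hcompA.
translate; apply: (@hcomp_tensl (reverse C) H 1 1 1 1 _ _ _ v u); whiskered.
Qed.

Lemma PiLE : PiL M D = hPiL M D (braid H H).
Proof.
apply: mor_eq_eq; apply: mor_eq_sym; rewrite /PiL.
apply: mor_eq_trans (mor_eq_sym (recast_mor_eq _ _ _)); rewrite /hPiL; translate.
Qed.

Lemma PiRE : PiR M D = hPiL M' D' (braid H H).
Proof.
apply: mor_eq_eq; apply: mor_eq_sym; rewrite /PiR.
apply: mor_eq_trans (mor_eq_sym (recast_mor_eq _ _ _)); rewrite /hPiL; translate.
Qed.

Lemma hdelta_mu_braid : delta_mu_compat M D -> hdelta_mu M D (braid H H).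
Proof.
rewrite /delta_mu_compat /delta2 => a1; apply: mor_eq_eq.
apply: (mor_eq_trans (g := δ ∘ μ)); first by translate.
rewrite a1; apply: mor_eq_sym.
rewrite -rwhisk_lwhisk -!hcompA [rwhisk (hmu M) • _]hcompA.
translate1; first by apply: (@hcomp_tensr C H 2 1 2 1 _ _ _ μ μ); whiskered.
apply: mor_eq_trans (mor_eq_sym (recast_mor_eq _ _ _)).
translate1; first by translate.
by apply: (@hcomp_tensr C H 1 2 1 2 _ _ _ δ δ); whiskered.
Qed.

(* Reversing the tensor product leaves [delta_mu_compat] unchanged up to
   bracketing. *)
Lemma hdelta_mu_reverse : delta_mu_compat M D -> hdelta_mu M' D' (braid H H).
Proof.
rewrite /delta_mu_compat /delta2 => a1; apply: mor_eq_eq.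
apply: (mor_eq_trans (g := δ ∘ μ)); first by translate.
rewrite a1; apply: mor_eq_sym; rewrite -!hcompA [rwhisk (hmu _) • _]hcompA.
translate1; first by apply: (@hcomp_tensr (reverse C) H 2 1 2 1 _ _ _ μ μ); whiskered.
apply: mor_eq_trans (mor_eq_sym (recast_mor_eq _ _ _)).
translate1; first by translate.
by apply: (@hcomp_tensr (reverse C) H 1 2 1 2 _ _ _ δ δ); whiskered.
Qed.

(** Each of the last four antipode axioms is [mu (u * v ⊗ 1)] or
    [mu (1 ⊗ u * v)] with the product reassociated. *)
Lemma is_antipodeP l : is_antipode M D l <->
  [/\ conv M D (idm H) l = PiL M D, conv M D l (idm H) = PiR M D,
      conv M D l (PiL M D) = l & conv M D (PiR M D) l = l].
Proof.
split=> [[PL PR lPL PRl _ _ _ _]|[PL PR lPL PRl]] //.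
split=> //; rewrite -?PL -?PR.
- rewrite convE; apply: mor_eq_sym.
  apply: (mor_eq_trans (g := hmu M • rwhisk (hconv M D l (idm H)))).
    by apply: mor_eq_sym; translate.
  rewrite -mul_hconvr; translate.
  by apply: (@hcomp_tensl C H 1 1 2 1 _ _ _ l μ); whiskered.
- rewrite convE; apply: mor_eq_sym.
  apply: (mor_eq_trans (g := hmu M • rwhisk (hconv M D (idm H) l))).
    by apply: mor_eq_sym; translate.
  by rewrite -mul_hconvl; translate.
- rewrite conv_reverse; apply: mor_eq_sym.
  apply: (mor_eq_trans (g := hmu M' • rwhisk (hconv M' D' l (idm H)))).
    by apply: mor_eq_sym; translate.
  rewrite -mul_hconvr; translate.
  by apply: (@hcomp_tensl (reverse C) H 1 1 2 1 _ _ _ l μ); whiskered.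
- rewrite conv_reverse; apply: mor_eq_sym.
  apply: (mor_eq_trans (g := hmu M' • rwhisk (hconv M' D' (idm H) l))).
    by apply: mor_eq_sym; translate.
  by rewrite -mul_hconvl rwhisk_lwhisk; translate.
Qed.

End Translation.

(** * The equivalence *)

Theorem corollary2p13
  (C : strict_braided) (hE : has_equalizers C) (hQ : has_coequalizers C)
  (H : C) (M : monoid H) (D : comonoid H)
  (a1 : delta_mu_compat M D) (a2 : weak_counit M D) (a3 : weak_unit M D)
  (SL1 : splitting (Omega1 M D (PiL M D)))
  (SR1 : splitting (Omega1 M D (PiR M D)))
  (SL2 : splitting (Omega2 M D (PiL M D)))
  (SR2 : splitting (Omega2 M D (PiR M D))) :
  [<-> weak_hopf_algebra M D;
       is_iso (spl_q SR1 ∘ galois_beta M D ∘ spl_j SL1)%mor;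
       is_iso (spl_q SL2 ∘ galois_gamma M D ∘ spl_j SR2)%mor].
Proof.
have PL1 : hconv M D (PiL M D) (idm H) = idm H.
  by rewrite PiLE; exact: hconv_hPiL (hdelta_mu_braid a1).
have PR1 : hconv (reverse_monoid M) (reverse_comonoid D) (PiR M D) (idm H) = idm H.
  by rewrite PiRE; exact: hconv_hPiL (hdelta_mu_reverse a1).
have i1 : weak_hopf_algebra M D <->
    is_iso (spl_q SR1 ∘ galois_beta M D ∘ spl_j SL1)%mor.
  rewrite betaE.
  have P1 := gal_iso PL1 _ (etrans (spl_jq SL1) (Omega1E _ _ _)) (spl_qj SL1)
    (etrans (spl_jq SR1) (Omega1E _ _ _)) (spl_qj SR1).
  apply: iff_trans (iff_sym (P1 _)).
    split=> [[_ _ _ [l /is_antipodeP[? ? ? ?]]]|[l [? ? ? ?]]].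
      by exists l; rewrite -!convE.
    by split=> //; exists l; apply/is_antipodeP; rewrite !convE.
  by rewrite -convE conv_reverse.
have i2 : weak_hopf_algebra M D <->
    is_iso (spl_q SL2 ∘ galois_gamma M D ∘ spl_j SR2)%mor.
  rewrite gammaE.
  have P1 := gal_iso PR1 _ (etrans (spl_jq SR2) (Omega2E _ _ _)) (spl_qj SR2)
    (etrans (spl_jq SL2) (Omega2E _ _ _)) (spl_qj SL2).
  apply: iff_trans (iff_sym (P1 _)).
    split=> [[_ _ _ [l /is_antipodeP[? ? ? ?]]]|[l [? ? ? ?]]].
      by exists l; rewrite -!conv_reverse.
    by split=> //; exists l; apply/is_antipodeP; rewrite !conv_reverse.
  by rewrite -conv_reverse convE.
tfae.
- by move/i1.
- by move/i1/i2.
- by move/i2.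
Qed.
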